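(* Let $p$ be an odd prime and let $K\leq\mathbb{Z}_p^*$ be a subgroup. Set $G$ equal to the semidirect product $\mathbb{Z}_p\rtimes K$, viewed as a subgroup of the affine group $AG(1,p)$. Let $\Delta$ be a generating set for $G$ such that each translation has a representative in $\Delta^*$ of length at most $p-1$. Then the Cayley graph $(G,\Delta)$ of $\mathbb{Z}_p\rtimes K$ is a Černý Cayley graph.
   Context: The affine group $AG(1,p)=\mathbb{Z}_p\rtimes\mathbb{Z}_p^*$ is the group of all maps $\mathbb{Z}_p\to\mathbb{Z}_p$ of the form $x\mapsto sx+r$ with $s\in\mathbb{Z}_p^*$, $r\in\mathbb{Z}_p$; $\mathbb{Z}_p\rtimes K$ is the subgroup of those with $s\in K$. Translations are the maps $x\mapsto x+r$, $r\in\mathbb{Z}_p$. For a finite set $X$, $T_X$ is the set of all maps $X\to X$, acting on the right of $X$. An automaton with state set $X$ is a subset $\Sigma\subseteq T_X$, written $(X,\Sigma)$. The free monoid $\Sigma^*$ acts on the right of $X$ via the homomorphism $\Sigma^*\to T_X$ extending the inclusion $\Sigma\hookrightarrow T_X$. A word $w\in\Sigma^*$ is synchronizing if $|Xw|=1$; the automaton is synchronizing if it admits a synchronizing word. If $G$ is a finite group with generating set $\Delta$, elements of $\Delta$ are identified with the right translations $g\mapsto gd$ of $G$, so $\Delta\subseteq T_G$; the automaton $(G,\Delta)$ is the Cayley graph of $G$ with respect to $\Delta$. With $n=|G|$, $(G,\Delta)$ is a Černý Cayley graph if every synchronizing automaton $(G,\Sigma)$ with $\Delta\subseteq\Sigma\subseteq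 T_G$ admits a synchronizing word of length at most $(n-1)^2$. *)

(* Defs.v *)
From HB Require Import structures.
From mathcomp Require Import all_boot all_order all_algebra all_fingroup.

Set Implicit Arguments.
Unset Strict Implicit.
Unset Printing Implicit Defensive.

Import GroupScope GRing.Theory.

(* The free monoid on A is represented by the lists of elements of A. *)
Definition word_over (T : finType) (A : {set T}) (w : seq T) : bool :=
  all (mem A) w.

Definition word_act (X : finType) (w : seq {ffun X -> X}) (x : X) : X :=
  foldl (fun y (f : {ffun X -> X}) => f y) x w.

Definition synchronizing_word (X : finType) (w : seq {ffun X -> X}) : Prop :=
  #|[set word_act w x | x : X]| = 1%N.

Definition synchronizing (X : finType) (Sigma : {set {ffun X -> X}}) : Prop :=
  exists w, word_over Sigma w /\ synchronizing_word w.

Definition right_translation (gT : finGroupType) (d : gT) : {ffun gT -> gT} :=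
  [ffun g => g * d].

Definition cayley_graph (gT : finGroupType) (Delta : {set gT}) :
    {set {ffun gT -> gT}} :=
  [set right_translation d | d in Delta].

(* The property is meant for Delta generating gT; this is assumed separately. *)
Definition cerny_cayley_graph (gT : finGroupType) (Delta : {set gT}) : Prop :=
  forall Sigma : {set {ffun gT -> gT}},
    cayley_graph Delta \subset Sigma -> synchronizing Sigma ->
    exists w, [/\ word_over Sigma w, synchronizing_word w
                & (size w <= (#|gT| - 1) ^ 2)%N].

(* 'F_p is the field Z/pZ only for prime p.  Permutations compose from left   *)
(* to right: (f * g) x = g (f x).                                             *)
Definition affine_map (p : nat) (s : {unit 'F_p}) (r x : 'F_p) : 'F_p :=
  (FinRing.uval s * x + r)%R.

Definition affine_set (p : nat) (K : {set {unit 'F_p}}) : {set {perm 'F_p}} :=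
  [set g : {perm 'F_p} |
    [exists s in K, exists r, forall x, g x == affine_map s r x]].

Lemma affine_group_set (p : nat) (K : {group {unit 'F_p}}) :
  group_set (affine_set K).
Proof.
apply/group_setP; split.
  rewrite inE; apply/existsP; exists 1; rewrite group1 /=.
  apply/existsP; exists 0%R; apply/forallP=> x.
  by rewrite perm1 /affine_map /= mul1r addr0.
move=> g h; rewrite !inE => /existsP[s /andP[Ks /existsP[r /forallP gE]]].
move=> /existsP[t /andP[Kt /existsP[q /forallP hE]]].
apply/existsP; exists (t * s); rewrite groupM //=.
apply/existsP; exists (FinRing.uval t * r + q)%R; apply/forallP=> x.
rewrite permM (eqP (hE _)) (eqP (gE _)) /affine_map /=.
by rewrite mulrDr mulrA addrA.
Qed.

Canonical affine_group (p : nat) (K : {group {unit 'F_p}}) :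
  {group {perm 'F_p}} := Group (affine_group_set K).

Definition is_translation (p : nat) (g : {perm 'F_p}) : Prop :=
  exists r : 'F_p, forall x, g x = (x + r)%R.

(* Main.v *)
Require Import Defs.
From mathcomp Require Import all_boot all_order all_algebra all_fingroup.
From mathcomp Require Import cyclic zify.
Set Implicit Arguments.
Unset Strict Implicit.
Unset Printing Implicit Defensive.
Import Order.TTheory GRing.Theory Num.Theory.

(** The argument works for every finite group G with a normal subgroup H of
    prime order p and index k < p such that every element of H is a product of
    at most p - 1 elements of Delta ([cerny_of_normal_prime]); the translations
    form such a subgroup of the affine group.  Put n = |G| = p k.

    A synchronizing word is built backwards.  Some letter is not injective, so
    some point has a preimage S with at least two elements; S is then enlarged
    to all of G by repeatedly replacing it with a larger preimage under a short
    word.  The step from S uses the rational function gam = 1_S - |S|/n, whose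
    sum after pulling back along a word w is |S w^-1| - |S|.  Let A be a family
    of group elements, each a product of at most l elements of Delta, over which
    the translates of gam add up to zero, and let d be the dimension of their
    span.  A strictly growing chain of subspaces gives a word w of length at
    most n - d for which some translate by a in A, pulled back along w, has
    nonzero sum.  Over A these sums add up to 0, so one of them is positive:
    w followed by a word for a enlarges S at a cost of at most n - d + l
    ([extension_step]).

    The dimension d is bounded from below modulo p: the translates of 1_S have
    at least as large a rank over the rationals as modulo p ([rank_map_int]),
    and centering loses at most one dimension ([rank_centered]).  If h generates H, then
    N = h - 1 is nilpotent of order p on functions with values in a field of
    characteristic p, and N^(p-1) is the sum over H.  Hence the rank of a
    H-stable family is at least p times the rank of the family of its H-sums
    ([translates_rank_pchar]), and the H-sum of the indicator of S is the
    function counting S in the cosets of H.  Suppose that p does not divide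
    |S|.  If all G-translates of the coset counts are proportional modulo p, the
    factors are 1, because the counts over all cosets always add up to |S|, and
    |S| is invertible modulo p; so S meets all cosets in the same number of
    points ([coset_count_rank]).  Every element of G is a product of at most
    (p - 1) + (k - 1) elements of Delta ([reach_all]).  This leaves three cases.
    - If S meets all cosets equally, then k divides |S|, the translates by H
      already add up to zero, and l = p - 1, d >= p - 1: the cost is at most n.
    - If the coset counts differ and p does not divide |S|, then l = p + k - 2
      and d >= 2 p - 1: the cost is at most n - 2.
    - If p divides |S|, then l = p + k - 2 and d >= 1: the cost is at most
      n + p + k - 3.
    Only k - 1 sizes are in the third case, and the gain of 2 in the second case
    pays for them: all costs add up to at most (n - 1)^2 ([cost_sum]). *)

(** * Pullbacks as matrices and short detecting words *)

Section LinearAlgebra.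
Local Open Scope ring_scope.

Section Pull.
Variables (F : fieldType) (X : finType).

Definition vec (phi : X -> F) : 'rV[F]_#|X| := \row_j phi (enum_val j).

(** The matrix of phi |-> phi \o a, acting on row vectors from the right. *)
Definition pull (a : X -> X) : 'M[F]_#|X| :=
  \matrix_(i, j) (enum_val i == a (enum_val j))%:R.

Definition ones : 'cV[F]_#|X| := const_mx 1.

Lemma sum_enum_val (f : X -> F) : \sum_(i < #|X|) f (enum_val i) = \sum_x f x.
Proof.
by rewrite [RHS](reindex (@enum_val X X)) //; apply: onW_bij; exact: enum_val_bij.
Qed.

Lemma vec_pull phi a : vec phi *m pull a = vec (phi \o a).
Proof.
apply/rowP=> j; rewrite !mxE; under eq_bigr do rewrite !mxE.
rewrite (sum_enum_val (fun x => phi x * (x == a (enum_val j))%:R)).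
rewrite (bigD1 (a (enum_val j))) //= eqxx mulr1 big1 ?addr0 // => x /negPf ->.
by rewrite mulr0.
Qed.

Lemma vec_ones phi : vec phi *m ones = (\sum_x phi x)%:M.
Proof.
apply/matrixP=> i j; rewrite !ord1 !mxE eqxx mulr1n -sum_enum_val.
by apply: eq_bigr => x _; rewrite !mxE mulr1.
Qed.

Lemma vec_eq phi psi : phi =1 psi -> vec phi = vec psi.
Proof. by move=> E; apply/rowP=> j; rewrite !mxE. Qed.

Lemma row_vec (A : 'M[F]_#|X|) i : row i A = vec (fun x => A i (enum_rank x)).
Proof. by apply/rowP=> j; rewrite !mxE enum_valK. Qed.

Lemma pull_eq a b : a =1 b -> pull a = pull b.
Proof. by move=> E; apply/matrixP=> i j; rewrite !mxE E. Qed.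

Lemma pull_id : pull id = 1%:M.
Proof. by apply/matrixP=> i j; rewrite !mxE (inj_eq enum_val_inj). Qed.

Lemma pull_comp a b : pull a *m pull b = pull (a \o b).
Proof.
apply/row_matrixP=> i; rewrite row_mul !row_vec vec_pull; apply: vec_eq => x /=.
by rewrite !mxE !enum_rankK.
Qed.

Lemma word_act_cat (w1 w2 : seq {ffun X -> X}) x :
  word_act (w1 ++ w2) x = word_act w2 (word_act w1 x).
Proof. by rewrite /word_act foldl_cat. Qed.

Lemma word_act_rcons (w : seq {ffun X -> X}) a x :
  word_act (rcons w a) x = a (word_act w x).
Proof. by rewrite /word_act foldl_rcons. Qed.

(** If the row space of Y is killed by the sum functional, then a letter that
    does not stabilize it enlarges it, and such a letter exists because some
    word detects Y.  The rank grows with every letter, which bounds the length. *)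
Lemma short_detecting_word (Sigma : {set {ffun X -> X}}) m
    (Y : 'M[F]_(m, #|X|)) w0 :
  word_over Sigma w0 -> Y *m pull (word_act w0) *m ones != 0 ->
  exists w, [/\ word_over Sigma w, (size w + \rank Y <= #|X|)%N
              & Y *m pull (word_act w) *m ones != 0].
Proof.
move=> Sw0; have [c] := ubnP (#|X| - \rank Y)%N.
elim: c m Y => // c IH m Y ltc ndet.
have [Y0 | nY0] := eqVneq (Y *m ones) 0; last first.
  exists [::]; split => //; first exact: rank_leq_col.
  by rewrite (_ : pull _ = 1%:M) ?mulmx1 // -pull_id; apply: pull_eq.
have [a /andP[Sa nYa] | stable] :=
  pickP [pred a | (a \in Sigma) && ~~ (Y *m pull a <= Y)%MS]; last first.
  case/negP: ndet; apply/eqP.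
  suff /submxP[D ->] : (Y *m pull (word_act w0) <= Y)%MS by rewrite -mulmxA Y0 mulmx0.
  elim: w0 Sw0 {IH} => [|a w IHw] /=.
    by rewrite (_ : pull _ = 1%:M) ?mulmx1 // -pull_id; apply: pull_eq.
  case/andP=> Sa /IHw le.
  have -> : pull (word_act (a :: w)) = pull (word_act w) *m pull a.
    by rewrite pull_comp; apply: pull_eq.
  rewrite mulmxA (submx_trans (submxMr _ le)) //.
  by have /negbT := stable a; rewrite /= Sa /= negbK.
(* A word detecting Y' detects either Y, or Y after one more letter a. *)
pose Y' := (Y + Y *m pull a)%MS.
have ltr : (\rank Y < \rank Y')%N.
  rewrite ltn_neqAle mxrankS ?addsmxSl // andbT.
  apply: contraNneq nYa => e.
  have := mxrank_leqif_sup (addsmxSl Y (Y *m pull a)).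
  move=> [_]; rewrite e eqxx => /esym /(submx_trans _) -> //.
  exact: addsmxSr.
have leX : (\rank Y' <= #|X|)%N by apply: rank_leq_col.
have [||w [Sw szw det]] := IH _ Y'.
- by rewrite -ltnS (leq_trans _ ltc) // ltnS ltn_sub2l // (leq_trans ltr).
- apply: contraNneq ndet => e; apply/eqP.
  have /submxP[D ->] := addsmxSl Y (Y *m pull a).
  by rewrite -!mulmxA mulmxA in e *; rewrite e mulmx0.
have [e0 | ne0] := eqVneq (Y *m pull (word_act w) *m ones) 0; last first.
  by exists w; split => //; rewrite (leq_trans _ szw) // leq_add2l ltnW.
exists (rcons w a); split.
- by rewrite /word_over all_rcons /= Sa.
- by rewrite size_rcons addSnnS (leq_trans _ szw) // leq_add2l.
have -> : pull (word_act (rcons w a)) = pull a *m pull (word_act w).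
  by rewrite pull_comp; apply: pull_eq => x; rewrite word_act_rcons.
apply: contraNneq det => e1; rewrite -mulmxA -submx0.
rewrite /Y' addsmxMr !mulmxA in e1 *.
by rewrite addsmx_sub e0 e1 !submx0 !eqxx.
Qed.

End Pull.

(** * Ranks in characteristic p *)

(** A nonzero minor over F1 is the image of an integer minor, which remains
    nonzero over F2 when every integer vanishing in F2 vanishes in F1.  The use
    is F1 of characteristic p and F2 the field of rationals. *)
Lemma rank_map_int (F1 F2 : fieldType) m n (A : 'M[int]_(m, n)) :
  (forall z : int, z%:~R = 0 :> F2 -> z%:~R = 0 :> F1) ->
  (\rank (map_mx intr A : 'M[F1]_(m, n))
   <= \rank (map_mx intr A : 'M[F2]_(m, n)))%N.
Proof.
move=> le12; set A1 : 'M[F1]_(m, n) := map_mx intr A; set A2 := (X in (_ <= \rank X)%N).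
pose f := maxrankfun A1; pose B1 := rowsub f A1.
have B1full : row_full B1^T by rewrite /row_full mxrank_tr; exact: maxrowsub_free.
pose g := fullrankfun B1full; pose C0 := rowsub g (rowsub f A)^T.
have C1unit : (map_mx intr C0 : 'M[F1]_ _) \in unitmx.
  suff -> : map_mx intr C0 = rowsub g B1^T by exact: fullrowsub_unit.
  by apply/matrixP=> i j; rewrite !mxE.
have C2unit : (map_mx intr C0 : 'M[F2]_ _) \in unitmx.
  move: C1unit; rewrite !unitmxE !unitfE !det_map_mx; apply: contraNneq => e.
  exact/eqP/le12.
suff eC2 : map_mx intr C0 = rowsub g (rowsub f A2)^T.
  rewrite -(mxrank_unit C2unit) eC2.
  apply: leq_trans (mxrankS (rowsub_sub _ _)) _.
  by rewrite mxrank_tr; exact: mxrankS (rowsub_sub _ _).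
by apply/matrixP=> i j; rewrite !mxE.
Qed.

(** Applying N to U N^i loses at least \rank (U N^q) dimensions, since
    U N^q is contained in U N^i and killed by N; this happens for q + 1
    values of i. *)
Lemma rank_nilpotent (F : fieldType) m n q (U : 'M[F]_(m, n)) (N : 'M[F]_n) :
  (U *m N <= U)%MS -> U *m (N ^+ q.+1) = 0 ->
  (q.+1 * \rank (U *m N ^+ q) <= \rank U)%N.
Proof.
move=> UN N0.
have mono i : (U *m N ^+ i.+1 <= U *m N ^+ i)%MS.
  by rewrite exprS -mulmxE mulmxA submxMr.
have decr j i : (U *m N ^+ (j + i) <= U *m N ^+ i)%MS.
  by elim: j => // j; apply: submx_trans; exact: mono.
have step i : (i <= q)%N -> (\rank (U *m N ^+ i.+1) + \rank (U *m N ^+ q) <= \rank (U *m N ^+ i))%N.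
  move=> le; rewrite -(mxrank_mul_ker (U *m N ^+ i) N).
  rewrite exprSr -mulmxE mulmxA leq_add2l mxrankS // sub_capmx.
  apply/andP; split; last by apply/sub_kermxP; rewrite -mulmxA -[_ *m N]/(N ^+ q * N) -exprSr.
  by rewrite -(subnK le) decr.
have: forall j, (j <= q.+1)%N -> (j * \rank (U *m N ^+ q) <= \rank (U *m N ^+ (q.+1 - j)))%N.
  elim=> [|j IH] lej; first by rewrite mul0n.
  have := step (q.+1 - j.+1)%N; rewrite subSS leq_subr => /(_ isT).
  rewrite -subSn // => h; apply: leq_trans h; rewrite mulSn addnC leq_add2r.
  exact/IH/ltnW.
by move/(_ q.+1 (leqnn _)); rewrite subnn expr0 mulmx1.
Qed.

Lemma bin_pred_pchar (F : fieldType) p i : p \in [pchar F] -> (i < p)%N ->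
  'C(p.-1, i)%:R = (-1) ^+ i :> F.
Proof.
move=> chF; have pr := pcharf_prime chF.
elim: i => [|i IH] lti; first by rewrite bin0 expr0.
have: 'C(p, i.+1)%:R = 0 :> F.
  by apply/eqP; rewrite -(dvdn_pcharf chF) prime_dvd_bin.
rewrite -{1}(prednK (prime_gt0 pr)) binS natrD (IH (ltnW lti)) => e.
by rewrite exprS mulN1r; apply/eqP; rewrite -addr_eq0 e.
Qed.

(** In characteristic p, (T - 1)^(p-1) = 1 + T + ... + T^(p-1): when T is a
    translation by a generator of a group of order p, this is the operator
    that sums over the group. *)
Lemma norm_powerE (F : fieldType) p n (T : 'M[F]_n) : p \in [pchar F] ->
  (T - 1) ^+ p.-1 = \sum_(i < p) T ^+ i.
Proof.
move=> chF; have pr := pcharf_prime chF; rewrite exprBn_comm; last exact: commr1.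
rewrite prednK ?prime_gt0 // [RHS](reindex_inj rev_ord_inj) /=.
apply: eq_bigr => i _; rewrite expr1n mulr1 -scaler_nat (bin_pred_pchar chF) //.
rewrite -subn1 -subnDA add1n -signr_odd -[(-1) ^+ i]signr_odd.
by case: (odd i); rewrite !(expr0, expr1, scale1r, mul1r, mulN1r, scaleN1r, opprK).
Qed.

End LinearAlgebra.

(** * Translates of a function on a group *)

Section Group.
Local Open Scope group_scope.
Variable gT : finGroupType.

Section Translates.
Variables (F : fieldType) (I : finType) (tr : I -> gT).
Implicit Types (phi : gT -> F).

(** The rows are the functions x |-> phi (x * tr i). *)
Definition translates phi : 'M[F]_(#|I|, #|gT|) :=
  (\matrix_(i, j) phi (enum_val j * tr (enum_val i))%g)%R.

Lemma row_translates phi i :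
  row i (translates phi) = vec (fun x => phi (x * tr (enum_val i))).
Proof. by apply/rowP=> j; rewrite !mxE. Qed.

Lemma cycle_sum (h : gT) (f : gT -> F) :
  (\sum_(i < #[h]) f (h ^+ i)%g = \sum_(y in <[h]>) f y)%R.
Proof.
have inj : injective (fun i : 'I_#[h] => h ^+ i).
  by move=> i j /eqP; rewrite eq_expg_ord // => /eqP.
have -> : <[h]> = [set h ^+ i | i : 'I_#[h]].
  apply/setP=> y; apply/idP/imsetP => [/cyclePmin[i lti ->]|[i _ ->]].
    by exists (Ordinal lti).
  exact: mem_cycle.
by rewrite big_imset //= => i j _ _; exact: inj.
Qed.

(** The family being stable under left multiplication by H, the operator
    N = h - 1, for a generator h of H, preserves the span of the translates;
    N^p = 0 and N^(p-1) maps each translate to its sum over H. *)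
Lemma translates_rank_pchar (H : {group gT}) p phi :
    p \in [pchar F]%R -> #|H| = p ->
    (forall i y, y \in H -> exists j, tr j = y * tr i) ->
  (p * \rank ((\matrix_(i, j) \sum_(y in H) phi (enum_val j * y * tr (enum_val i))%g)%R
               : 'M[F]_(#|I|, #|gT|))
   <= \rank (translates phi))%N.
Proof.
move=> chF cardH closed; have pr := pcharf_prime chF.
have /cyclicP[h defH] : cyclic H by rewrite prime_cyclic ?cardH.
have oh : #[h] = p by rewrite orderE -defH.
pose T : 'M[F]_#|gT| := pull F (fun x => x * h).
have Tpow i : (T ^+ i)%R = pull F (fun x => x * h ^+ i).
  elim: i => [|i IH].
    by rewrite GRing.expr0 -[LHS]pull_id; apply: pull_eq => x; rewrite mulg1.
  rewrite GRing.exprS IH -[LHS]/(_ *m _)%R pull_comp; apply: pull_eq => x /=.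
  by rewrite -mulgA -expgSr.
have normE : (translates phi *m (T - 1) ^+ p.-1)%R =
    (\matrix_(i, j) \sum_(y in H) phi (enum_val j * y * tr (enum_val i))%g)%R.
  apply/row_matrixP=> i; rewrite row_mul row_translates norm_powerE //.
  rewrite mulmx_sumr; apply/rowP=> j; rewrite summxE !mxE defH -cycle_sum oh.
  by apply: eq_bigr => k _; rewrite Tpow vec_pull !mxE.
rewrite -normE -{1}(prednK (prime_gt0 pr)); apply: rank_nilpotent.
  rewrite mulmxBr mulmx1 addmx_sub ?eqmx_opp //.
  apply/row_subP=> i; rewrite row_mul row_translates vec_pull.
  have [|j ej] := closed (enum_val i) h; first by rewrite defH cycle_id.
  apply: eq_row_sub (enum_rank j) _; rewrite row_translates; apply: vec_eq => x /=.
  by rewrite enum_rankK ej mulgA.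
have -> : ((T - 1) ^+ p.-1.+1 = 0)%R.
  rewrite GRing.exprS norm_powerE // -GRing.subrX1 Tpow -oh expg_order.
  rewrite -[X in (_ - X)%R]pull_id; apply/eqP; rewrite GRing.subr_eq0; apply/eqP.
  by apply: pull_eq => x; rewrite mulg1.
by rewrite mulmx0.
Qed.

End Translates.

(** * The extension step *)

Section Extension.
Variables (Delta : {set gT}) (Sigma : {set {ffun gT -> gT}}).
Hypothesis sDS : cayley_graph Delta \subset Sigma.

Definition reach (l : nat) (g : gT) : Prop :=
  exists u, [/\ word_over Delta u, size u <= l & \prod_(d <- u) d = g].

Definition centered (S : {set gT}) (x : gT) : rat :=
  ((x \in S)%:R - #|S|%:R / #|gT|%:R)%R.

Definition preim_word (w : seq {ffun gT -> gT}) (S : {set gT}) : {set gT} :=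
  [set x | word_act w x \in S].

Lemma reach_word l g : reach l g ->
  exists w, [/\ word_over Sigma w, size w <= l & word_act w =1 mulg^~ g].
Proof.
case=> u [Du szu <-]; exists [seq right_translation d | d <- u]; split.
- rewrite /word_over all_map; apply: sub_all Du => d /= Dd.
  by rewrite (subsetP sDS) // imset_f.
- by rewrite size_map.
elim: u {Du szu} => [|d u IH] x; first by rewrite big_nil /= mulg1.
by rewrite /= ffunE IH big_cons mulgA.
Qed.

(** Averaging turns a nonzero sum into a positive one.  The hypothesis on cards
    says that the translates of the centered indicator add up to zero. *)
Lemma extension_step (w0 : seq {ffun gT -> gT}) (S : {set gT}) (I : finType)
    (tr : I -> gT) (i0 : I) l :
    word_over Sigma w0 -> synchronizing_word w0 -> 0 < #|S| < #|gT| ->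
    (forall i, reach l (tr i)) ->
    (forall x, #|[set i | (x * tr i)%g \in S]| * #|gT| = #|S| * #|I|)%N ->
  exists w, [/\ word_over Sigma w,
     size w + \rank (translates tr (centered S)) <= #|gT| + l
   & #|S| < #|preim_word w S|].
Proof.
move=> Sw0 sync /andP[S_gt0 S_lt] rtr avg.
pose q : rat := (#|S|%:R / #|gT|%:R)%R; set gam := centered S.
have gamE x : gam x = ((x \in S)%:R - q)%R by [].
have n_gt0 : (0 < #|gT|%:R :> rat)%R by rewrite ltr0n (leq_ltn_trans _ S_lt).
have q_gt0 : (0 < q)%R by rewrite divr_gt0 // ltr0n.
have q_lt1 : (q < 1)%R by rewrite ltr_pdivrMr // mul1r ltr_nat.
have gam_sum (f : gT -> gT) : (\sum_x gam (f x) = #|[set x | f x \in S]|%:R - #|S|%:R)%R.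
  under eq_bigr do rewrite gamE; rewrite sumrB -natr_sum; congr (_%:R - _)%R.
    by rewrite -sum1dep_card [RHS]big_mkcond; apply: eq_bigr => x _; case: ifP.
  by rewrite sumr_const -[(q *+ _)%R]mulr_natr /q divfK // gt_eqF.
have gam0 x : (\sum_i gam (x * tr i)%g = 0)%R.
  under eq_bigr do rewrite gamE; rewrite sumrB -natr_sum sumr_const; apply/eqP; rewrite subr_eq0.
  rewrite -[(q *+ _)%R]mulr_natr /q mulrAC -natrM.
  have -> : (\sum_i ((x * tr i)%g \in S) = #|[set i | (x * tr i)%g \in S]|)%N.
    by rewrite -sum1dep_card [RHS]big_mkcond; apply: eq_bigr => i _; case: ifP.
  by rewrite -[X in X == _](mulfK (lt0r_neq0 n_gt0)) -natrM avg.
have gam_ne0 x : gam x != 0%R.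
  rewrite gamE; case: (x \in S); first by rewrite subr_eq0 eq_sym lt_eqF.
  by rewrite sub0r oppr_eq0 gt_eqF.
have rowE w i : row i (translates tr gam *m pull rat (word_act w) *m ones rat gT)
    = (\sum_x gam (word_act w x * tr (enum_val i))%g)%:M%R.
  by rewrite !row_mul row_translates vec_pull vec_ones.
have [|w [Sw szw det]] := short_detecting_word (Y := translates tr gam) Sw0.
  (* w0 detects: it turns gam into a constant, and gam vanishes nowhere. *)
  have /eqP/cards1P[x0 ex0] := sync.
  apply/eqP=> /(congr1 (row (enum_rank i0))); rewrite rowE row0 enum_rankK.
  have cst x : word_act w0 x = x0.
    by apply/set1P; rewrite -ex0 imset_f.
  move/matrixP/(_ 0 0)%R/eqP; rewrite !mxE eqxx mulr1n.
  under eq_bigr do rewrite cst.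
  by rewrite sumr_const -mulr_natr mulf_eq0 (negPf (gam_ne0 _)) gt_eqF.
pose f i := (\sum_x gam (word_act w x * tr i)%g)%R.
have sumf : (\sum_i f i = 0)%R.
  by rewrite exchange_big big1.
have [i fi_gt0] : exists i, (0 < f i)%R.
  have [/existsP[i ?]|/existsPn npos] := boolP [exists i, 0 < f i]%R; first by exists i.
  case/negP: det; apply/eqP/row_matrixP=> i; rewrite rowE row0.
  have nneg j : true -> (0 <= - f j)%R by move=> _; rewrite oppr_ge0 leNgt npos.
  have /eqP : (\sum_j - f j = 0)%R by rewrite sumrN sumf oppr0.
  rewrite psumr_eq0 // => /allP /(_ (enum_val i)).
  rewrite mem_index_enum oppr_eq0 => /(_ isT) /eqP f0.
  by rewrite -[(\sum_x _)%R]/(f _) f0 raddf0.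
have [u [Su szu uE]] := reach_word (rtr i).
exists (w ++ u); split.
- by rewrite /word_over all_cat; apply/andP.
- by rewrite size_cat addnAC leq_add.
rewrite -(ltr_nat rat) -subr_gt0; move: fi_gt0; rewrite /f gam_sum.
suff -> : preim_word (w ++ u) S = [set x | word_act w x * tr i \in S] by [].
by apply/setP=> x; rewrite !inE word_act_cat uE.
Qed.

End Extension.
End Group.

(** * Counting a set in the cosets of a normal subgroup *)

Section Cosets.
Local Open Scope group_scope.
Variables (gT : finGroupType) (H : {group gT}).
Hypothesis nH : H <| [set: gT].
Let p := #|H|.
Let k := #|[set: gT] : H|.
Hypothesis pr : prime p.

Lemma card_mul_index : #|gT| = (p * k)%N.
Proof. by rewrite -cardsT Lagrange ?subsetT. Qed.

Definition coset_count (S : {set gT}) x := #|S :&: H :* x|.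

Lemma coset_count_le S x : coset_count S x <= p.
Proof. by rewrite /p -(card_rcoset H x) subset_leq_card // subsetIr. Qed.

(** Right multiplication by g permutes the cosets, so the total does not depend
    on g. *)
Lemma coset_count_sum (S : {set gT}) g :
  #|S| = (\sum_(C in rcosets H [set: gT]) coset_count S (repr C * g)%g)%N.
Proof.
rewrite -sum1_card (partition_big (fun x => H :* (x * g^-1)) (mem (rcosets H setT))) /=.
  apply: eq_bigr => C /rcosetsP[r _ ->]; rewrite sum1dep_card /coset_count.
  apply: eq_card => x; rewrite !inE; congr (_ && _).
  rewrite -{1}(rcoset_repr H r) (sameP eqP rcoset_eqP) !mem_rcoset.
  by rewrite invMg mulgA.
by move=> x _; apply/rcosetsP; exists (x * g^-1); rewrite ?inE.
Qed.

(** By normality x H g is the coset H x g, so the H-sums of the translates of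
    the indicator of S are the translates of its coset counts. *)
Lemma coset_count_translate (F : fieldType) (S : {set gT}) x g :
  (\sum_(y in H) ((x * y * g)%g \in S)%:R = (coset_count S (x * g)%g)%:R :> F)%R.
Proof.
have inj : injective (fun y => x * y * g) by move=> y z /mulIg /mulgI.
have eqC : H :* (x * g) = [set x * y * g | y in H].
  apply/setP=> z; rewrite rcosetM norm_rlcoset ?(subsetP (normal_norm nH)) ?inE //.
  rewrite mem_rcoset mem_lcoset; apply/idP/imsetP => [Hz|[y Hy ->]].
    by exists (x^-1 * (z * g^-1)); rewrite // mulKVg mulgKV.
  by rewrite mulgK mulKg.
rewrite /coset_count eqC -sum1_card natr_sum.
rewrite [RHS](eq_bigl (fun z => (z \in [set x * y * g | y in H]) && (z \in S))); last first.
  by move=> z; rewrite inE andbC.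
rewrite [RHS]big_mkcondr big_imset /=; last by move=> ? ? _ _; exact: inj.
by apply: eq_bigr => y _; case: ifP.
Qed.

(** If the translates of the coset counts span a line modulo p, they are
    proportional to the counts; summing over the cosets shows that the factor
    is 1, because |S| is invertible modulo p.  So the counts are all congruent
    modulo p, and nonzero, hence they are equal, as they lie between 1 and
    p - 1. *)
Lemma coset_count_rank (F : fieldType) (S : {set gT}) : p \in [pchar F]%R -> ~~ (p %| #|S|) ->
  (forall x, coset_count S x = coset_count S 1) \/
  (2 <= \rank (\matrix_(i < #|gT|, j < #|gT|)
                 (coset_count S (enum_val j * enum_val i)%g)%:R : 'M[F]_#|gT|)%R).
Proof.
move=> chF ndv; set W := (\matrix_(i, j) _)%R; have [|rkW] := leqP 2 (\rank W); [by right | left].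
pose nu x : F := (coset_count S x)%:R%R.
have rowW g : row (enum_rank g) W = vec (fun x => nu (x * g)).
  by apply/rowP=> j; rewrite !mxE enum_rankK.
have nu_neq0 : vec nu != 0%R.
  apply: contraNneq ndv => nu0; rewrite (coset_count_sum S 1); apply: dvdn_sum => C _.
  rewrite (dvdn_pcharf chF) mulg1.
  move/rowP/(_ (enum_rank (repr C))): nu0; rewrite !mxE enum_rankK => e.
  exact/eqP.
have nuE g : exists a : F, forall x, nu (x * g) = (a * nu x)%R.
  have nuW : (vec nu <= W)%MS.
    apply: (eq_row_sub (enum_rank 1)); rewrite rowW.
    by apply: vec_eq => x; rewrite mulg1.
  have Wnu : (W <= vec nu)%MS.
    by rewrite -(geq_leqif (mxrank_leqif_sup nuW)) rank_rV nu_neq0.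
  have /sub_rVP[a ea] : (row (enum_rank g) W <= vec nu)%MS.
    by apply: submx_trans Wnu; exact: row_sub.
  exists a => x; rewrite rowW in ea.
  by move/rowP/(_ (enum_rank x)): ea; rewrite !mxE enum_rankK.
have S_neq0 : (#|S|%:R != 0 :> F)%R by rewrite -(dvdn_pcharf chF).
have inv g : nu g = nu 1.
  have [a ea] := nuE g; have := ea 1; rewrite mul1g => ->.
  suff -> : a = 1%R by rewrite mul1r.
  apply: (mulIf S_neq0); rewrite mul1r {2}(coset_count_sum S g) natr_sum.
  rewrite (coset_count_sum S 1) natr_sum mulr_sumr; apply: eq_bigr => C _.
  by rewrite mulg1 -[RHS]/(nu _) ea.
have lt_p x : coset_count S x < p.
  rewrite ltn_neqAle coset_count_le andbT; apply: contraNneq ndv => e.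
  rewrite (coset_count_sum S 1); apply: dvdn_sum => C _.
  by rewrite (dvdn_pcharf chF) -[X in (X == _)%R]/(nu _) inv -(inv x) /nu e (pcharf0 chF).
have wl y z : coset_count S y <= coset_count S z ->
    nu y = nu z -> coset_count S y = coset_count S z.
  move=> le e; apply/eqP; rewrite eqn_leq le /= -subn_eq0.
  rewrite -[_ == _]negbK -lt0n; apply/negP => gt0.
  have : p %| coset_count S z - coset_count S y.
    by rewrite (dvdn_pcharf chF) natrB // subr_eq0 -[X in (X == _)%R]/(nu z) -e eqxx.
  by move/(dvdn_leq gt0); rewrite leqNgt (leq_ltn_trans (leq_subr _ _)).
move=> x; case/orP: (leq_total (coset_count S x) (coset_count S 1)) => le.
  exact: wl (inv x).
by apply/esym; apply: wl => //; exact/esym.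
Qed.

(** The set of cosets reached by words of length at most j grows until it is stable
    under Delta, so k - 1 letters reach every coset; an element of H then
    corrects the position inside the coset. *)
Lemma reach_all Delta : <<Delta>> = [set: gT] ->
  (forall h, h \in H -> reach Delta p.-1 h) -> forall g, reach Delta (p.-1 + k.-1) g.
Proof.
move=> gen reachH.
have grow j : exists R : {set {set gT}}, [/\ H :* 1 \in R,
    forall C, C \in R -> exists2 g, reach Delta j g & C = H :* g
  & j < #|R| \/ forall g, H :* g \in R].
  elim: j => [|j [R [R1 RE Rbig]]].
    exists [set H :* 1]; split; rewrite ?set11 ?cards1; [by []| |by left].
    by move=> C /set1P ->; exists 1; rewrite //; exists [::]; rewrite big_nil.
  have weaken C : C \in R -> exists2 g, reach Delta j.+1 g & C = H :* g.
    case/RE=> g [u [Du szu <-]] ->; exists (\prod_(d <- u) d) => //.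
    by exists u; split=> //; exact: leqW.
  case: Rbig => [ltj | all]; last by exists R; split=> //; right.
  have [[C d] /= /and3P[RC Dd nR] | closed] :=
      pickP [pred Cd : {set gT} * gT | [&& Cd.1 \in R, Cd.2 \in Delta & Cd.1 :* Cd.2 \notin R]].
    exists (C :* d |: R); split; first by rewrite !inE R1 orbT.
      move=> C' /setU1P[-> | /weaken //]; have [g [u [Du szu eu]] ->] := RE _ RC.
      exists (g * d); last by rewrite rcosetM.
      exists (rcons u d); rewrite /word_over all_rcons /= Dd size_rcons; split=> //.
      by rewrite -cats1 big_cat big_seq1 eu.
    by left; rewrite cardsU1 nR.
  exists R; split=> //; right => g.
  have /gen_prodgP[m [c Dc ->]] : g \in <<Delta>> by rewrite gen inE.
  elim: m c Dc => [|m IH] c Dc; first by rewrite big_ord0.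
  rewrite big_ord_recr /= rcosetM.
  have /negbT := closed (H :* \prod_(i < m) c (widen_ord (leqnSn m) i), c ord_max).
  by rewrite /= Dc IH //= negbK.
move=> g; have [R [_ RE Rbig]] := grow k.-1.
have sR : R \subset rcosets H [set: gT].
  by apply/subsetP=> C /RE[x _ ->]; apply/rcosetsP; exists x; rewrite ?inE.
have : H :* g \in R.
  case: Rbig => [ltk | //]; have /eqP -> : R == rcosets H [set: gT].
    by rewrite eqEcard sR; move: ltk; rewrite prednK /k ?indexg_gt0.
  by apply/rcosetsP; exists g; rewrite ?inE.
case/RE=> x [u [Du szu eu]] /rcoset_eqP.
rewrite mem_rcoset => /reachH[v [Dv szv ev]].
exists (v ++ u); split.
- by rewrite /word_over all_cat; apply/andP.
- by rewrite size_cat leq_add.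
- by rewrite big_cat /= ev eu mulgKV.
Qed.

End Cosets.

(** * The cost of enlarging a set *)

(** The bounds of the three cases for a set of s elements in a group of order
    p * k.  Equal coset counts force k to divide s; when k divides s although
    the counts differ, the bound p * k is merely not sharp. *)
Definition cost (p k s : nat) : nat :=
  if p %| s then (p * k + p + k - 3)%N else if k %| s then (p * k)%N else (p * k - 2)%N.

Section LargerPreimage.
Local Open Scope group_scope.
Variables (gT : finGroupType).

Section Ranks.
Variables (I : finType) (tr : I -> gT) (S : {set gT}).

Lemma rank_centered :
  \rank (translates tr (fun x => (x \in S)%:R : rat)%R)
  <= (\rank (translates tr (centered S))).+1.
Proof.
have -> : translates tr (fun x => (x \in S)%:R : rat)%R
    = (translates tr (centered S)
       + const_mx 1 *m (const_mx (#|S|%:R / #|gT|%:R) : 'rV_#|gT|))%R.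
  by apply/matrixP=> i j; rewrite !mxE big_ord1 !mxE mul1r subrK.
apply: leq_trans (mxrank_add _ _) _; rewrite -[X in _ <= X]addn1 leq_add2l.
exact: leq_trans (mxrankM_maxl _ _) (rank_leq_col _).
Qed.

Lemma rank_translates_pchar (F : fieldType) p : p \in [pchar F]%R ->
  (\rank (translates tr (fun x => (x \in S)%:R : F)%R)
   <= \rank (translates tr (fun x => (x \in S)%:R : rat)%R))%N.
Proof.
move=> chF; pose A : 'M[int]_(#|I|, #|gT|) :=
  (\matrix_(i, j) ((enum_val j * tr (enum_val i))%g \in S)%:R)%R.
have E (R : fieldType) : translates tr (fun x => (x \in S)%:R : R)%R = map_mx intr A.
  by apply/matrixP=> i j; rewrite !mxE; case: (_ \in S).
rewrite !E; apply: rank_map_int => z /eqP.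
by rewrite intr_eq0 => /eqP ->.
Qed.

End Ranks.

Section Cost.
Variables (H : {group gT}) (Delta : {set gT}) (Sigma : {set {ffun gT -> gT}}).
Hypotheses (nH : H <| [set: gT]) (prH : prime #|H|).
Hypothesis ltkp : #|[set: gT] : H| < #|H|.
Hypothesis genD : <<Delta>> = [set: gT].
Hypothesis reachH : forall h, h \in H -> reach Delta #|H|.-1 h.
Hypothesis sDS : cayley_graph Delta \subset Sigma.
Variable w0 : seq {ffun gT -> gT}.
Hypotheses (Sw0 : word_over Sigma w0) (sync0 : synchronizing_word w0).

(** Translates by all of G serve when p divides |S| or the coset counts differ;
    translates by H alone when the coset counts are equal. *)
Lemma larger_preimage (S : {set gT}) : 0 < #|S| < #|gT| ->
  exists w, [/\ word_over Sigma w, size w <= cost #|H| #|[set: gT] : H| #|S|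
              & #|S| < #|preim_word w S|].
Proof.
move=> ltS; pose p := #|H|; pose k := #|[set: gT] : H|.
have ltkp' : k < p by [].
have en : #|gT| = (p * k)%N by exact: card_mul_index.
have k_gt0 : 0 < k by rewrite indexg_gt0.
have p_gt1 := prime_gt1 prH.
have avgG x : (#|[set i | (x * id i)%g \in S]| * #|gT| = #|S| * #|gT|)%N.
  congr (_ * _)%N; rewrite -(card_imset [set i | x * i \in S] (mulgI x)).
  apply: eq_card => z; apply/imsetP/idP => [[y]|Sz]; first by rewrite inE => ? ->.
  by exists (x^-1 * z); rewrite ?inE mulKVg.
have reachG := reach_all genD reachH.
have stepG := extension_step sDS (1 : gT) Sw0 sync0 ltS reachG avgG.
have [w [Sw szw gtS]] := stepG.
rewrite /cost; case: ifPn => [dvS | ndvS].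
  exists w; split=> //.
  (* S is neither empty nor G, so its centered indicator is nonzero. *)
  have : 0 < \rank (translates id (centered S)).
    have /andP[/card_gt0P[x Sx] ltSn] := ltS.
    rewrite lt0n mxrank_eq0; apply/eqP => /matrixP/(_ (enum_rank 1) (enum_rank x))/eqP.
    rewrite !mxE !enum_rankK mulg1 /centered Sx subr_eq0 eq_sym lt_eqF //.
    by rewrite ltr_pdivrMr ?mul1r ?ltr_nat // ltr0n (leq_ltn_trans _ ltSn).
  rewrite -/p -/k in szw *; move: szw; set r := \rank _ => szw r_gt0.
  by apply: leq_trans (_ : #|gT| + (p.-1 + k.-1) - r <= _); lia.
have chF := pchar_Fp prH.
have [cst | rk2] := coset_count_rank (S := S) chF ndvS.
  have dvk : k %| #|S|.
    rewrite (coset_count_sum H S 1) (eq_bigr (fun=> coset_count H S 1)).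
      by rewrite sum_nat_const dvdn_mulr.
    by move=> C _.
  rewrite dvk; pose tr (i : 'I_#|H|) := enum_val i : gT.
  have i0 : 'I_#|H| := Ordinal (ltnW p_gt1).
  have avgH x : (#|[set i | (x * tr i)%g \in S]| * #|gT| = #|S| * #|{: 'I_#|H|}|)%N.
    rewrite card_ord.
    have -> : #|[set i | (x * tr i)%g \in S]| = coset_count H S (x * 1).
      apply/eqP; rewrite -(eqr_nat rat) -coset_count_translate // big_enum_val /=.
      rewrite -natr_sum -sum1dep_card big_mkcond; apply/eqP; congr (_%:R)%R.
      by apply: eq_bigr => i _; rewrite mulg1; case: ifP.
    rewrite cst en [in RHS](coset_count_sum H S 1).
    rewrite (eq_bigr (fun=> coset_count H S 1)); last by move=> C _.
    by rewrite sum_nat_const -[#|rcosets _ _|]/k mulnCA [RHS]mulnC [(k * _)%N]mulnC.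
  have reachH' i : reach Delta p.-1 (tr i) by apply: reachH; exact: enum_valP.
  have [w' [Sw' szw' gtS']] := extension_step sDS i0 Sw0 sync0 ltS reachH' avgH.
  exists w'; split=> //.
  (* The coset counts are nonzero modulo p, so their translates have rank at
     least 1. *)
  have : (p * 1 <= (\rank (translates tr (centered S))).+1)%N.
    apply: leq_trans _ (rank_centered _ _).
    apply: leq_trans _ (rank_translates_pchar tr S chF).
    apply: leq_trans _ (translates_rank_pchar _ chF (erefl p) _); last first.
      move=> i y Hy; exists (enum_rank_in (group1 H) (y * tr i)).
      by rewrite /tr enum_rankK_in // groupM ?enum_valP.
    rewrite leq_mul2l lt0n mxrank_eq0; apply/orP; right.
    apply: contraNneq ndvS => e; rewrite (coset_count_sum H S 1).
    apply: dvdn_sum => C _; rewrite (dvdn_pcharf chF).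
    move/matrixP/(_ (enum_rank i0) (enum_rank (repr C * 1 * (tr i0)^-1))): e.
    rewrite !mxE coset_count_translate // !enum_rankK mulgKV => e.
    exact/eqP.
  rewrite -/p -/k in szw' *; move: szw'; set r := \rank _ => szw' r_gt0; lia.
have rkG : (p * 2 <= (\rank (translates id (centered S))).+1)%N.
  apply: leq_trans _ (rank_centered _ _).
  apply: leq_trans _ (rank_translates_pchar _ S chF).
  apply: leq_trans _ (translates_rank_pchar _ chF (erefl p) _); last first.
    by move=> i y _; exists (y * i).
  rewrite leq_mul2l (leq_trans rk2) ?orbT //.
  apply: eq_leq; congr (\rank _); apply/matrixP=> i j; rewrite !mxE.
  by rewrite coset_count_translate.
exists w; split=> //; rewrite -/p -/k in szw rkG *; move: szw rkG.
set r := \rank _ => szw rkG; case: ifP => _; lia.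
Qed.

End Cost.
End LargerPreimage.

(** * The total cost *)

(** For k >= 2, at most p - 1 sizes t in [2, n) are multiples of k and at most
    k - 1 are multiples of p.  The saving of 2 at the other sizes pays for the
    latter because k < p.  For k = 1 no size is a multiple of p. *)
Lemma cost_sum p k : 1 < p -> 0 < k < p ->
  1 + \sum_(2 <= t < p * k) cost p k t <= (p * k - 1) ^ 2.
Proof.
move=> p_gt1 /andP[k_gt0 ltkp].
suff : \sum_(2 <= t < p * k) cost p k t <= (p * k - 2) * (p * k).
  have : 2 <= p * k by rewrite -[2]muln1 leq_mul.
  set s := \sum_(_ <= _ < _) _; move: s (p * k) => s [|[|n]] // _.
  rewrite -mulnn subn2 subn1 /=; lia.
case: k => [|[|k]] // in k_gt0 ltkp *.
  rewrite muln1 -sum_nat_const_nat big_seq_cond [X in _ <= X]big_seq_cond.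
  apply: leq_sum => t; rewrite mem_index_iota andbT => /andP[t2 tp].
  rewrite /cost gtnNdvd ?dvd1n ?muln1 //; lia.
set k' := k.+2 in ltkp *; set n := (p * k')%N.
(* Replacing the case distinction by a sum of indicators only increases the
   cost: n - 2 + (p + k - 1) is the exceptional value n + p + k - 3. *)
pose f t := (n - 2 + 2 * (k' %| t) + (p + k' - 1) * (p %| t))%N.
have n_ge4 : 4 <= n by rewrite -[4]/(2 * 2) leq_mul.
have le_f t : cost p k' t <= f t.
  rewrite /cost /f -/n.
  by case: (p %| t); case: (k' %| t) => /=; rewrite /k'; lia.
have mult d e : 0 < d -> 0 < e -> \sum_(2 <= t < d * e) (d %| t) <= e.-1.
  move=> d0 e0; case: (ltnP 1 (d * e)) => [lt1|le1]; last first.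
    by rewrite big_geq // ltnW.
  have -> : e.-1 = (d * e).-1 %/ d.
    case: e e0 {lt1} => // e _; rewrite mulnS -{1}[d]prednK // addSn /= addnC mulnC.
    by rewrite divnMDl // divn_small ?addn0 // prednK.
  rewrite divn_count_dvd // prednK ?muln_gt0 ?d0 //.
  by rewrite [X in _ <= X]big_ltn // leq_addl.
apply: leq_trans (leq_sum _ (fun t _ => le_f t)) _.
rewrite /f !big_split /= -!big_distrr /= sum_nat_const_nat.
have m1 := mult k' p isT (ltnW p_gt1); rewrite mulnC -/n in m1.
have m2 := mult p k' (ltnW p_gt1) isT; rewrite -/n in m2.
have B : (n - 2) * (n - 2) + 2 * p.-1 + (p + k' - 1) * k'.-1 <= (n - 2) * n.
  have -> : (n - 2) * n = (n - 2) * (n - 2) + (n - 2) * 2.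
    by rewrite -mulnDr subnK // (leq_trans _ n_ge4).
  rewrite -addnA leq_add2l.
  have [j ep] : exists j, p = j + k.+3 by exists (p - k.+3); rewrite subnK.
  rewrite /n /k' ep {n f le_f m1 m2 mult n_ge4 ltkp ep}; lia.
apply: leq_trans B; apply: leq_add; first apply: leq_add => //.
  by rewrite big1_eq addn0 addnn -mul2n leq_mul2l m1.
by rewrite leq_mul2l m2 orbT.
Qed.

Section Sync.
Local Open Scope group_scope.
Variables (gT : finGroupType) (H : {group gT}) (Delta : {set gT}).

(** The sizes of the successive preimages increase strictly, so each size s is
    paid for at most once, which makes [cost_sum] a bound for the total. *)
Theorem cerny_of_normal_prime : H <| [set: gT] -> prime #|H| ->
    #|[set: gT] : H| < #|H| -> <<Delta>> = [set: gT] ->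
    (forall h, h \in H -> reach Delta #|H|.-1 h) ->
  cerny_cayley_graph Delta.
Proof.
move=> nH prH ltkp genD reachH Sigma sDS [w0 [Sw0 sync0]].
pose p := #|H|; pose k := #|[set: gT] : H|.
have k_gt0 : 0 < k by rewrite indexg_gt0.
have p_gt1 : 1 < p := prime_gt1 prH.
have en : #|gT| = (p * k)%N by exact: card_mul_index.
have n_gt1 : 1 < #|gT| by rewrite en (leq_trans p_gt1) // leq_pmulr.
have chain s : 1 < s <= #|gT| -> exists w x, [/\ word_over Sigma w,
    s <= #|preim_word w [set x]| & size w <= 1 + \sum_(2 <= t < s) cost p k t].
  elim: s => [|s IH] // /andP[]; rewrite ltnS leq_eqVlt => /predU1P[<- _|s_gt1 lts].
    have [a Sa ninj] : exists2 a, a \in Sigma & ~~ injectiveb a.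
      have [/existsP[a /andP[]]|/existsPn allinj] :=
        boolP [exists a, (a \in Sigma) && ~~ injectiveb a]; first by exists a.
      have inj : injective (word_act w0).
        elim: (w0) Sw0 => [|a w IHw] /= => [_ x y //|/andP[Sa Sw] x y /(IHw Sw)].
        have := allinj a; rewrite Sa /= negbK => /injectiveP; exact.
      by move: n_gt1; rewrite -(card_imset _ inj) [#|_|]sync0.
    have /injectivePn[x [y ne e]] := ninj.
    exists [:: a], (a x); rewrite big_geq //=; split=> //; first by rewrite /word_over /= Sa.
    have <- : #|[set x; y]| = 2 by rewrite cards2 ne.
    by apply/subset_leq_card/subsetP=> z; rewrite !inE /= => /orP[] /eqP ->; rewrite ?e.
  have [|w [x [Sw les szw]]] := IH; first by rewrite s_gt1 ltnW.
  rewrite big_nat_recr //= addnA; move: les; rewrite leq_eqVlt => /predU1P[es | lts'].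
    have [|v [Sv szv gts]] := larger_preimage nH prH ltkp genD reachH sDS Sw0 sync0
        (S := preim_word w [set x]); first by rewrite -es lts ltnW.
    exists (v ++ w), x; split.
    - by rewrite /word_over all_cat; apply/andP.
    - rewrite es (leq_trans gts) //; apply/subset_leq_card/subsetP=> y.
      by rewrite !inE word_act_cat.
    - by rewrite size_cat addnC leq_add // es.
  by exists w, x; split=> //; rewrite (leq_trans szw) // leq_addr.
have [|w [x [Sw les szw]]] := chain #|gT|; first by rewrite n_gt1 leqnn.
exists w; split=> //.
  rewrite /synchronizing_word (_ : [set _ | _ in _] = [set x]) ?cards1 //.
  have full : preim_word w [set x] = setT.
    by apply/eqP; rewrite eqEcard subsetT cardsT.
  apply/setP=> z; rewrite inE; apply/imsetP/eqP => [[y _ ->]|->].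
    by have := in_setT y; rewrite -full !inE => /eqP.
  exists x => //; have := in_setT x; by rewrite -full !inE => /eqP.
apply: leq_trans szw _; rewrite en; apply: cost_sum => //.
by rewrite k_gt0.
Qed.

End Sync.

(** * The translations in the affine group *)

Import GroupScope.

Section Affine.
Variables (p : nat) (K : {group {unit 'F_p}}).
Hypothesis p_prime : prime p.

Definition translation (r : 'F_p) : {perm 'F_p} := perm (@GRing.addIr 'F_p r).

Lemma translation_affine r : translation r \in affine_set K.
Proof.
rewrite inE; apply/existsP; exists 1; rewrite group1 /=.
apply/existsP; exists r; apply/forallP=> x.
by rewrite permE /affine_map /= GRing.mul1r.
Qed.

Lemma translation_inj : injective translation.
Proof. by move=> r q /permP/(_ 0%R); rewrite !permE !GRing.add0r. Qed.

Lemma affineP (g : {perm 'F_p}) : g \in affine_set K ->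
  exists s r : 'F_p, s != 0%R /\ forall x, g x = (s * x + r)%R.
Proof.
rewrite inE => /existsP[s /andP[_ /existsP[r /forallP gE]]].
exists (FinRing.uval s), r; split; last by move=> x; exact/eqP.
by rewrite -GRing.unitfE; exact: valP.
Qed.

Definition translations : {set [subg affine_group K]} :=
  [set subg (affine_group K) (translation r) | r : 'F_p].

Lemma translationsP t :
  reflect (is_translation (sgval t)) (t \in translations).
Proof.
apply: (iffP imsetP) => [[r _ ->]|[r tE]].
  by exists r => x; rewrite subgK ?translation_affine // permE.
exists r => //; apply: subg_inj; rewrite subgK ?translation_affine //.
by apply/permP=> x; rewrite tE permE.
Qed.

Lemma translations_group_set : group_set translations.
Proof.
apply/group_setP; split.
  by apply/translationsP; exists 0%R => x; rewrite perm1 GRing.addr0.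
move=> t u /translationsP[r tE] /translationsP[q uE]; apply/translationsP.
by exists (r + q)%R => x; rewrite permM tE uE GRing.addrA.
Qed.
Canonical translations_group := Group translations_group_set.

Lemma card_translations : #|translations| = p.
Proof.
rewrite card_imset ?card_Fp // => r q /(congr1 (@sgval _ _)).
by rewrite !subgK ?translation_affine // => /translation_inj.
Qed.

Lemma translations_normal : translations <| [set: [subg affine_group K]].
Proof.
rewrite /normal subsetT; apply/subsetP=> g _; rewrite inE; apply/subsetP=> u /imsetP[t Ht ->].
have /translationsP[q tE] := Ht; apply/translationsP.
have /affineP[s [r [_ gE]]] := subgP g.
exists (s * q)%R => x; rewrite /conjg /= !permM tE gE GRing.mulrDr GRing.addrAC -gE.
by rewrite permKV.
Qed.

(** An affine map g is determined by (g 0, g 1 - g 0), whose second entry is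
    nonzero, so the group has at most p (p - 1) elements. *)
Lemma index_translations : #|[set: [subg affine_group K]] : translations| < p.
Proof.
have p_gt0 := prime_gt0 p_prime.
have cardG : #|[set: [subg affine_group K]]| <= p * p.-1.
  pose f (t : [subg affine_group K]) := (sgval t 0, sgval t 1 - sgval t 0)%R.
  have inj : injective f.
    move=> t u /eqP; rewrite xpair_eqE => /andP[/eqP e0 /eqP].
    have /affineP[s [r [_ tE]]] := subgP t.
    have /affineP[s' [r' [_ uE]]] := subgP u.
    move: e0; rewrite !tE !uE !GRing.mulr0 !GRing.add0r !GRing.mulr1 !GRing.addrK => er es.
    by apply: subg_inj; apply/permP=> x; rewrite tE uE er es.
  rewrite -(card_imset _ inj).
  apply: (@leq_trans #|setX [set: 'F_p] [set~ 0%R]|).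
    apply/subset_leq_card/subsetP=> _ /imsetP[t _ ->]; rewrite !inE /=.
    have /affineP[s [r [s0 tE]]] := subgP t.
    by rewrite !tE GRing.mulr0 GRing.add0r GRing.mulr1 GRing.addrK.
  by rewrite cardsX cardsT cardsC1 card_Fp.
have := Lagrange (subsetT translations_group).
rewrite card_translations => e; move: cardG; rewrite -e leq_pmul2l //.
by rewrite -[X in _ -> _ < X](prednK p_gt0) ltnS.
Qed.

End Affine.

Theorem theorem5p5 (p : nat) (p_prime : prime p) (p_odd : odd p)
    (K : {group {unit 'F_p}}) (Delta : {set [subg affine_group K]})
    (Delta_gen : <<Delta>> = [set: [subg affine_group K]])
    (Delta_trans : forall t : [subg affine_group K],
       is_translation (sgval t) ->
       exists w : seq [subg affine_group K],
         [/\ word_over Delta w, (size w <= p - 1)%N & \prod_(d <- w) d = t]) :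
  cerny_cayley_graph Delta.
Proof.
have cardH := card_translations K p_prime.
apply: (@cerny_of_normal_prime _ (translations_group K)); rewrite ?cardH //.
- exact: translations_normal.
- exact: index_translations.
move=> t /translationsP/Delta_trans[w [Dw szw prodw]].
by exists w; rewrite -subn1.
Qed.
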